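(* Let $K$ be a $^*$-continuous KAT with top, $A$ a top Kleene abstract domain of $K$ with maps $\alpha,\gamma$, and $T_{\Sigma,B}$ a KAT language interpreted on $K$. For all $a,b\in K$ and $t\in T_{\Sigma,B}$, if $[a]\,t\,[b]$ is derivable in the proof system $\mathrm{LCTK}_A$, then (i) $\top b\le\top a\llbracket t\rrbracket_u$, and (ii) $\mathcal S^\sharp[t]\,\alpha(\top a)=\alpha(\top b)=\alpha(\top a\llbracket t\rrbracket_u)$.
   Context: Idempotent semiring: $(K,+,0)$ commutative monoid with $a+a=a$, $(K,\cdot,1)$ monoid, two-sided distributivity, $0a=a0=0$; $a\le b$ iff $a+b=b$. KAT: idempotent semiring with Boolean subalgebra $\mathrm{Test}(K)$ (join $+$, meet $\cdot$, complement, bottom $0$, top $1$) and ${}^*$ with $1+aa^*\le a^*$, $1+a^*a\le a^*$, $b+ac\le c\Rightarrow a^*b\le c$, $b+ca\le c\Rightarrow ba^*\le c$. TopKAT: KAT with a greatest element $\top$; $^*$-continuous: for all $a,b,c$, $\bigvee_nab^nc$ exists and equals $ab^*c$. $\mathrm{TOP}(K)=\{\top a\mid a\in K\}$. Language: disjoint $\Sigma,B$ ($\mathtt0,\mathtt1\in B$), $\mathrm{Atom}=\Sigma\cup B$, terms $t::=\mathtt a\mid\mathtt0\mid\mathtt1\mid t_1+t_2\mid t_1\cdot t_2\mid t^*$; evaluation $u:\mathrm{Atom}\to K$ with $u(B)\subseteq\mathrm{Test}(K)$, extended homomorphically to $\llbracket\cdot\rrbracket_u$. Top Kleene abstract domain: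 poset $A$, Galois insertion $\alpha:\mathrm{TOP}(K)\to A$, $\gamma:A\to\mathrm{TOP}(K)$ ($\alpha(x)\le_Ay\iff x\le\gamma(y)$, $\alpha\gamma=\mathrm{id}$), countably complete. Abstract semantics: $\mathcal S^\sharp[\mathtt c]x=\alpha(\gamma(x)\llbracket\mathtt c\rrbracket_u)$, $\mathcal S^\sharp[t_1+t_2]x=\mathcal S^\sharp[t_1]x\vee_A\mathcal S^\sharp[t_2]x$, $\mathcal S^\sharp[t_1\cdot t_2]x=\mathcal S^\sharp[t_2](\mathcal S^\sharp[t_1]x)$, $\mathcal S^\sharp[t^*]x=\bigvee_n(\mathcal S^\sharp[t])^nx$. For $x\in\mathrm{TOP}(K)$, $A(x):=\gamma(\alpha(x))$. For $c,b\in K$, $A$ is locally complete for $c$ on $b$, written $\mathbb C^A_b(c)$, iff $A(\top bc)=A(A(\top b)c)$. $\mathrm{LCTK}_A$ rules (triples $[a]t[b]$, $a,b\in K$): (transfer) $\mathtt c\in\mathrm{Atom}$, $\mathbb C^A_a(\llbracket\mathtt c\rrbracket_u)$ $\vdash[a]\mathtt c[a\llbracket\mathtt c\rrbracket_u]$; (relax) $\top a'\le\top a\le A(\top a')$, $[a']t[b']$, $\top b\le\top b'\le A(\top b)$ $\vdash[a]t[b]$; (seq) $[a]t_1[r]$, $[r]t_2[b]$ $\vdash[a]t_1\cdot t_2[b]$; (join) $[a]t_1[b_1]$, $[a]t_2[b_2]$ $\vdash[a]t_1+t_2[b_1+b_2]$; (rec) $[a]t[r]$, $[a+r]t^*[b]$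 $\vdash[a]t^*[b]$; (iterate) $[a]t[b]$, $\top b\le A(\top a)$ $\vdash[a]t^*[a+b]$. *)

(* Defs.v *)
From HB Require Import structures.
From mathcomp Require Import all_boot all_order all_algebra.
From mathcomp Require Import all_classical.

Set Implicit Arguments.
Unset Strict Implicit.
Unset Printing Implicit Defensive.

Import Order.TTheory GRing.Theory.
Local Open Scope classical_set_scope.
Local Open Scope ring_scope.

HB.mixin Record PzSemiRing_isIdempotent K of GRing.PzSemiRing K := {
  addkk : idempotent_op (+%R : K -> K -> K)
}.

#[short(type="idemSemiRingType")]
HB.structure Definition IdemSemiRing :=
  { K of PzSemiRing_isIdempotent K & GRing.PzSemiRing K }.

Definition kle (K : idemSemiRingType) (a b : K) : Prop := a + b = b.

Notation "a <=k b" := (kle a b) (at level 70, no associativity) : ring_scope.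

(* [T] with join [+], meet [*], bottom [0] and top [1] is a Boolean algebra
   (complements in a Boolean algebra are unique, hence the mere existence). *)
Record boolean_subalgebra (K : idemSemiRingType) (T : set K) : Prop := {
  bsa0 : T 0;
  bsa1 : T 1;
  bsaD : forall p q, T p -> T q -> T (p + q);
  bsaM : forall p q, T p -> T q -> T (p * q);
  bsaMC : forall p q, T p -> T q -> p * q = q * p;
  bsaMid : forall p, T p -> p * p = p;
  bsaDK : forall p q, T p -> T q -> p + p * q = p;
  bsaMK : forall p q, T p -> T q -> p * (p + q) = p;
  bsaDM : forall p q r, T p -> T q -> T r -> p + q * r = (p + q) * (p + r);
  bsaC : forall p, T p -> exists q, [/\ T q, p + q = 1 & p * q = 0]
}.

HB.mixin Record IdemSemiRing_isKAT K of IdemSemiRing K := {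
  test : set K;
  star : K -> K;
  test_boolean : boolean_subalgebra test;
  star_unfoldl : forall a, 1 + a * star a <=k star a;
  star_unfoldr : forall a, 1 + star a * a <=k star a;
  star_indl : forall a b c, b + a * c <=k c -> star a * b <=k c;
  star_indr : forall a b c, b + c * a <=k c -> b * star a <=k c
}.

#[short(type="katType")]
HB.structure Definition KAT := { K of IdemSemiRing_isKAT K & IdemSemiRing K }.

HB.mixin Record KAT_isTopKAT K of KAT K := {
  ktop : K;
  kle_top : forall a, a <=k ktop
}.

#[short(type="topKatType")]
HB.structure Definition TopKAT := { K of KAT_isTopKAT K & KAT K }.

Definition star_continuous (K : katType) : Prop :=
  forall a b c : K,
    (forall n, a * b ^+ n * c <=k a * star b * c) /\
    (forall z, (forall n, a * b ^+ n * c <=k z) -> a * star b * c <=k z).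

Section TopElements.
Variable K : topKatType.

Definition TOP : set K := range (fun a : K => ktop * a).

Lemma TOP_topmul (a : K) : ktop * a \in TOP.
Proof. by apply: mem_set; exists a. Qed.

Definition topmul (a : K) : TOP := exist _ (ktop * a) (TOP_topmul a).

Lemma TOP_mulr (x : TOP) (k : K) : val x * k \in TOP.
Proof.
case: x => x /= /set_mem[a _ <-]; apply: mem_set.
by exists (a * k) => //; rewrite mulrA.
Qed.

Definition TOPmul (x : TOP) (k : K) : TOP := exist _ (val x * k) (TOP_mulr x k).

End TopElements.

Arguments TOP : clear implicits.

Record katLang := KatLang {
  action : Type;
  ptest : Type;
  ptest0 : ptest;
  ptest1 : ptest;
  ptest01 : ptest0 <> ptest1
}.

(* The disjoint union of actions and primitive tests. *)
Definition atom (L : katLang) : Type := (action L + ptest L)%type.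

(* The symbols 0 and 1 are primitive tests, so the constant terms 0 and 1 are
   the atoms [ptest0] and [ptest1]. *)
Inductive term (L : katLang) : Type :=
| tatom of atom L
| tadd of term L & term L
| tmul of term L & term L
| tstar of term L.

Definition term0 (L : katLang) : term L := tatom (inr (ptest0 L)).
Definition term1 (L : katLang) : term L := tatom (inr (ptest1 L)).

Record evaluation (L : katLang) (K : katType) := Evaluation {
  eval_atom :> atom L -> K;
  eval_test : forall p : ptest L, test (eval_atom (inr p));
  eval0 : eval_atom (inr (ptest0 L)) = 0;
  eval1 : eval_atom (inr (ptest1 L)) = 1
}.

Fixpoint interp (L : katLang) (K : katType) (u : evaluation L K) (t : term L)
    : K :=
  match t with
  | tatom c => u c
  | tadd t1 t2 => interp u t1 + interp u t2
  | tmul t1 t2 => interp u t1 * interp u t2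
  | tstar t1 => star (interp u t1)
  end.

(* [TOP K] carries the order of [K]. *)
Record topKleeneDomain (K : topKatType) (d : Order.disp_t) (A : porderType d) :=
  TopKleeneDomain {
  alpha : TOP K -> A;
  gamma : A -> TOP K;
  galois_connection : forall (x : TOP K) (y : A),
    (alpha x <= y)%O <-> val x <=k val (gamma y);
  galois_insertion : forall y : A, alpha (gamma y) = y;
  countably_complete : forall S : set A, countable S -> supremums S !=set0
}.

Section LCTK.
Variables (K : topKatType) (d : Order.disp_t) (A : porderType d).
Variables (D : topKleeneDomain K A) (L : katLang) (u : evaluation L K).

(* The first argument of [supremum] is its value on the empty set, or on a set
   without supremum: irrelevant for the nonempty countable sets used here. *)
Definition ajoin (x y : A) : A := supremum x [set x; y].

Fixpoint asem (t : term L) : A -> A :=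
  match t with
  | tatom c => fun x => alpha D (TOPmul (gamma D x) (u c))
  | tadd t1 t2 => fun x => ajoin (asem t1 x) (asem t2 x)
  | tmul t1 t2 => fun x => asem t2 (asem t1 x)
  | tstar t1 => fun x => supremum x (range (fun n => iter n (asem t1) x))
  end.

Definition aclosure (x : TOP K) : TOP K := gamma D (alpha D x).

Definition locally_complete (b c : K) : Prop :=
  aclosure (TOPmul (topmul b) c) = aclosure (TOPmul (aclosure (topmul b)) c).

Inductive lctk : K -> term L -> K -> Prop :=
| lctk_transfer a c :
    locally_complete a (u c) -> lctk a (tatom c) (a * u c)
| lctk_relax a a' t b b' :
    ktop * a' <=k ktop * a -> ktop * a <=k val (aclosure (topmul a')) ->
    lctk a' t b' ->
    ktop * b <=k ktop * b' -> ktop * b' <=k val (aclosure (topmul b)) ->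
    lctk a t b
| lctk_seq a r b t1 t2 :
    lctk a t1 r -> lctk r t2 b -> lctk a (tmul t1 t2) b
| lctk_join a b1 b2 t1 t2 :
    lctk a t1 b1 -> lctk a t2 b2 -> lctk a (tadd t1 t2) (b1 + b2)
| lctk_rec a r b t :
    lctk a t r -> lctk (a + r) (tstar t) b -> lctk a (tstar t) b
| lctk_iterate a b t :
    lctk a t b -> ktop * b <=k val (aclosure (topmul a)) ->
    lctk a (tstar t) (a + b).

End LCTK.

(* Main.v *)
(** Writing [f] for the abstract semantics of [t], the abstract semantics is
    sound: [alpha (x * [[t]]) <= f (alpha x)] for all [x] in [TOP K], where the
    star case is *-continuity.  Hence (i) already gives
    [alpha (top b) <= alpha (top a [[t]]) <= f (alpha (top a))], and the
    equalities (ii) reduce to [f (alpha (top a)) <= alpha (top b)].  In the rule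
    (rec) this last bound needs no additivity of [f]: it follows from the
    monotonicity of the abstract star along [a <= a + r]. *)
Require Import Defs.
From HB Require Import structures.
From mathcomp Require Import all_boot all_order all_algebra.
From mathcomp Require Import all_classical.

Set Implicit Arguments.
Unset Strict Implicit.
Unset Printing Implicit Defensive.

Local Open Scope ring_scope.

Import Order.TTheory GRing.Theory.
Local Open Scope classical_set_scope.

Section IdemSemiRingOrder.
Variable K : idemSemiRingType.
Implicit Types a b c : K.

Lemma kle_refl a : a <=k a. Proof. exact: addkk. Qed.

Lemma kle_trans b a c : a <=k b -> b <=k c -> a <=k c.
Proof. by rewrite /kle => ab bc; rewrite -bc addrA ab. Qed.

Lemma kle_addl a b : a <=k a + b. Proof. by rewrite /kle addrA addkk. Qed.

Lemma kle_addr a b : b <=k a + b. Proof. by rewrite addrC; exact: kle_addl. Qed.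

Lemma kle_add_lub a b c : a <=k c -> b <=k c -> a + b <=k c.
Proof. by rewrite /kle => ac bc; rewrite -addrA bc. Qed.

Lemma kle_mul2l c a b : a <=k b -> c * a <=k c * b.
Proof. by rewrite /kle => ab; rewrite -mulrDr ab. Qed.

Lemma kle_mul2r c a b : a <=k b -> a * c <=k b * c.
Proof. by rewrite /kle => ab; rewrite -mulrDl ab. Qed.

End IdemSemiRingOrder.

Section KATStar.
Variable K : katType.
Implicit Types a : K.

Lemma one_kle_star a : 1 <=k star a.
Proof. exact: kle_trans (kle_addl _ _) (star_unfoldl a). Qed.

Lemma mul_star_kle a : a * star a <=k star a.
Proof. exact: kle_trans (kle_addr _ _) (star_unfoldl a). Qed.

Lemma kle_star a : a <=k star a.
Proof.
apply: kle_trans (mul_star_kle a); rewrite -{1}[a]mulr1.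
exact/kle_mul2l/one_kle_star.
Qed.

End KATStar.

(** Both hypotheses keep [supremum] away from its default [x0]: the first excludes the empty set,
    the second lets [xget] return a genuine supremum. *)
Lemma supremum_is_supremum d (A : porderType d) (x0 : A) (S : set A) :
  S !=set0 -> supremums S !=set0 -> supremums S (supremum x0 S).
Proof. by move=> /set0P/negbTE S0 [s Ss]; rewrite /supremum S0; exact: xgetI Ss. Qed.

Section TopKleeneDomainTheory.
Variables (K : topKatType) (d : Order.disp_t) (A : porderType d).
Variable D : topKleeneDomain K A.
Implicit Types (x y : TOP K) (a b : K) (p q r : A).

Lemma kle_aclosure x : val x <=k val (aclosure D x).
Proof. exact/(galois_connection D). Qed.

Lemma alpha_mono x y : val x <=k val y -> (alpha D x <= alpha D y)%O.
Proof. by move=> xy; apply/galois_connection; exact: kle_trans (kle_aclosure y). Qed.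

Lemma gamma_mono p q : (p <= q)%O -> val (gamma D p) <=k val (gamma D q).
Proof. by move=> pq; apply/galois_connection; rewrite galois_insertion. Qed.

(** The side conditions of the relax rule have exactly this shape, so relaxing a triple changes
    neither of its two abstractions. *)
Lemma alpha_squeeze x y :
  val x <=k val y -> val y <=k val (aclosure D x) -> alpha D x = alpha D y.
Proof. by move=> xy yx; apply/le_anti; rewrite alpha_mono //=; apply/galois_connection. Qed.

Lemma supremum_range_ub p0 (f : nat -> A) n :
  (f n <= supremum p0 (range f))%O.
Proof.
have [ub _] : supremums (range f) (supremum p0 (range f)).
  apply: supremum_is_supremum; first by exists (f 0); exists 0.
  exact: (countably_complete D (card_image_le _ _)).
by apply: ub; exists n.
Qed.

Lemma supremum_range_le p0 (f : nat -> A) q :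
  (forall n, f n <= q)%O -> (supremum p0 (range f) <= q)%O.
Proof.
move=> fq; have [_] : supremums (range f) (supremum p0 (range f)).
  apply: supremum_is_supremum; first by exists (f 0); exists 0.
  exact: (countably_complete D (card_image_le _ _)).
by apply=> _ [n _ <-].
Qed.

Lemma ajoin_supremum p q : supremums [set p; q] (ajoin p q).
Proof.
apply: supremum_is_supremum; first by exists p; left.
by apply: (countably_complete D); exact: finite_set_countable.
Qed.

Lemma le_ajoinl p q : (p <= ajoin p q)%O.
Proof. by have [ub _] := ajoin_supremum p q; apply: ub; left. Qed.

Lemma le_ajoinr p q : (q <= ajoin p q)%O.
Proof. by have [ub _] := ajoin_supremum p q; apply: ub; right. Qed.

Lemma ajoin_le p q r : (p <= r)%O -> (q <= r)%O -> (ajoin p q <= r)%O.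
Proof. by move=> pr qr; have [_] := ajoin_supremum p q; apply=> _ [->|->]. Qed.

Section AbstractSemantics.
Variables (L : katLang) (u : evaluation L K).
Implicit Types t : term L.

Lemma asem_mono t : {homo asem D u t : p q / (p <= q)%O}.
Proof.
elim: t => [c|t1 IH1 t2 IH2|t1 IH1 t2 IH2|t IH] p q pq /=.
- exact/alpha_mono/kle_mul2r/gamma_mono.
- apply: ajoin_le; [apply: le_trans (le_ajoinl _ _) | apply: le_trans (le_ajoinr _ _)].
    exact: IH1.
  exact: IH2.
- exact/IH2/IH1.
(* The two stars are compared iterate by iterate, at equal [n]. *)
- apply: supremum_range_le => n; apply: le_trans (supremum_range_ub _ _ n).
  by elim: n => //= n; exact: IH.
Qed.

Lemma asem_sound (Kcont : star_continuous K) t x :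
  (alpha D (TOPmul x (interp u t)) <= asem D u t (alpha D x))%O.
Proof.
elim: t x => [c|t1 IH1 t2 IH2|t1 IH1 t2 IH2|t IH] x /=.
- exact/alpha_mono/kle_mul2r/kle_aclosure.
(* Crossing the Galois connection turns the bound into one in [K], where the sum is the least upper
   bound; each summand is then carried back to [A]. *)
- apply/galois_connection; rewrite /= mulrDr; apply: kle_add_lub.
    by apply/(galois_connection D (TOPmul x _)); exact: le_trans (IH1 x) (le_ajoinl _ _).
  by apply/(galois_connection D (TOPmul x _)); exact: le_trans (IH2 x) (le_ajoinr _ _).
- have -> : TOPmul x (interp u t1 * interp u t2)
          = TOPmul (TOPmul x (interp u t1)) (interp u t2).
    by apply: val_inj; rewrite /= mulrA.
  exact: le_trans (IH2 _) (@asem_mono _ _ _ (IH1 x)).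
(* The trailing factor 1 gives the product the two-sided shape of [star_continuous], which reduces
   the star to its finite powers. *)
- apply/galois_connection; rewrite /= -[_ * star _]mulr1.
  apply: (Kcont _ _ _).2 => n; rewrite mulr1.
  apply/(galois_connection D (TOPmul x _)).
  apply: le_trans (supremum_range_ub _ _ n).
  elim: n => [|n IHn] /=.
    by apply: alpha_mono; rewrite /= mulr1; exact: kle_refl.
  (* The new factor is split off on the right, to match the outermost application in [iter]. *)
  have -> : TOPmul x (interp u t ^+ n.+1)
          = TOPmul (TOPmul x (interp u t ^+ n)) (interp u t).
    by apply: val_inj; rewrite /= exprSr mulrA.
  exact: le_trans (IH _) (@asem_mono _ _ _ IHn).
Qed.

Lemma lctk_under_approx a t b :
  lctk D u a t b -> ktop * b <=k ktop * a * interp u t.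
Proof.
elim=> {a t b} [a c _|a a' t b b' a'a _ _ IH bb' _|a r b t1 t2 _ IH1 _ IH2
  |a b1 b2 t1 t2 _ IH1 _ IH2|a r b t _ IH1 _ IH2|a b t _ IH _] /=.
- by rewrite mulrA; exact: kle_refl.
- exact: kle_trans bb' (kle_trans IH (kle_mul2r _ a'a)).
- by rewrite mulrA; exact: kle_trans IH2 (kle_mul2r _ IH1).
- rewrite !mulrDr; apply: kle_add_lub.
    exact: kle_trans IH1 (kle_addl _ _).
  exact: kle_trans IH2 (kle_addr _ _).
(* The part from [r] is bounded through [IH1] by [a] followed by one step and a star, and the star
   absorbs that step. *)
- apply: kle_trans IH2 _; rewrite mulrDr mulrDl.
  apply: kle_add_lub; first exact: kle_refl.
  apply: kle_trans (kle_mul2r _ IH1) _; rewrite -[_ * interp _ _ * _]mulrA.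
  exact/kle_mul2l/mul_star_kle.
- rewrite mulrDr; apply: kle_add_lub.
    rewrite -{1}[ktop * a]mulr1; exact/kle_mul2l/one_kle_star.
  by apply: kle_trans IH _; exact/kle_mul2l/kle_star.
Qed.

Lemma lctk_asem_le a t b :
  lctk D u a t b -> (asem D u t (alpha D (topmul a)) <= alpha D (topmul b))%O.
Proof.
elim=> {a t b} [a c lc|a a' t b b' a'a aa' _ IH bb' b'b|a r b t1 t2 _ IH1 _ IH2
  |a b1 b2 t1 t2 _ IH1 _ IH2|a r b t _ IH1 _ IH2|a b t _ IH ba] /=.
(* Since [alpha] after [gamma] is the identity, local completeness becomes an equality in [A], one
   side of which is the abstract transfer. *)
- have := congr1 (alpha D) lc; rewrite /aclosure !galois_insertion => <-.
  by apply: alpha_mono; rewrite /= mulrA; exact: kle_refl.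
- by rewrite -(@alpha_squeeze (topmul a') (topmul a)) // (@alpha_squeeze (topmul b) (topmul b')).
- exact: le_trans (@asem_mono _ _ _ IH1) IH2.
- apply: ajoin_le; [apply: le_trans IH1 _ | apply: le_trans IH2 _];
    apply: alpha_mono; apply: kle_mul2l; [exact: kle_addl | exact: kle_addr].
- apply: le_trans IH2; apply: (@asem_mono (tstar t)).
  exact/alpha_mono/kle_mul2l/kle_addl.
(* By [IH] and [ba], the abstract semantics of [t] sends [alpha D (topmul a)] below itself; by
   monotonicity all iterates stay below it. *)
- apply: (@le_trans _ _ (alpha D (topmul a))); last exact/alpha_mono/kle_mul2l/kle_addl.
  apply: supremum_range_le; elim=> //= n IHn.
  apply: le_trans (@asem_mono _ _ _ IHn) (le_trans IH _).
  exact/galois_connection.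
Qed.

End AbstractSemantics.
End TopKleeneDomainTheory.

Theorem theorem9 (K : topKatType) (Kcont : star_continuous K)
    (d : Order.disp_t) (A : porderType d) (D : topKleeneDomain K A)
    (L : katLang) (u : evaluation L K) (a b : K) (t : term L) :
  lctk D u a t b ->
  ktop * b <=k ktop * a * interp u t /\
  (asem D u t (alpha D (topmul a)) = alpha D (topmul b) /\
   alpha D (topmul b) = alpha D (TOPmul (topmul a) (interp u t))).
Proof.
move=> abt; have under := lctk_under_approx abt.
have lower : (alpha D (topmul b) <= alpha D (TOPmul (topmul a) (interp u t)))%O.
  exact: alpha_mono.
have sound := asem_sound D u Kcont t (topmul a).
have upper := lctk_asem_le abt.
split=> //; split; apply/le_anti.
  by rewrite upper (le_trans lower sound).
by rewrite lower (le_trans sound upper).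
Qed.
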